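(* Let $(D,S,F)$ be a POA signature and let $\Gamma$ be a set of $(D,S,F)$-transitions. Let $\mathit{Mod}(D\cup S,F)$ be the category of many-sorted $(D\cup S,F)$-algebras and homomorphisms, let $\mathit{Mod}(D,S,F)$ be the category of preordered $(D,S,F)$-algebras and POA homomorphisms, and let $\mathit{Mod}(D,S,F,\Gamma)$ be the full subcategory of $\mathit{Mod}(D,S,F)$ given by the preordered algebras satisfying $\Gamma$. Then the forgetful functor $\mathcal{U}\colon \mathit{Mod}(D,S,F,\Gamma)\to \mathit{Mod}(D\cup S,F)$, $(A,\leqslant)\mapsto A$, has a left adjoint which is also a left inverse of $\mathcal{U}$ in the diagrammatic order of composition (i.e. applying first the left adjoint and then $\mathcal{U}$ gives the identity functor of $\mathit{Mod}(D\cup S,F)$), and which maps any $(D\cup S,F)$-algebra $B$ to the preordered algebra $(B,\stackrel{*}{\longrightarrow}_{\Gamma/B})$.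
   Context: POA signatures. A POA signature is a triple $(D,S,F)$ with $D\cap S=\emptyset$ and $(D\cup S,F)$ a many-sorted algebraic signature (operation symbols $\sigma\in F_{w\to s}$, with arity $w$ and sort $s$); elements of $D$ are data sorts, elements of $S$ are system sorts. Terms and variables are those of $(D\cup S,F)$. Atoms are equations $t=t'$ between terms of the same sort, and transitions $t\Rightarrow t'$ between terms of the same system sort. A $(D,S,F)$-transition is a Horn sentence $\forall X\, H\to (t\Rightarrow t')$, where $X$ is a set of variables, $H$ is a finite conjunction of atoms (equations and/or transitions), and the atoms are over $(D\cup S,F\cup X)$. $H_=$ is the set of equations and $H_\to$ the set of transitions in $H$, viewed as sets of pairs of terms. Preordered algebras. A preordered $(D,S,F)$-algebra $(A,\leqslant)$ is a $(D\cup S,F)$-algebra $A$ with a preorder $\leqslant_s$ on $A_s$ for each $s\in S$, such that $A_\sigma$ is monotone for each operation symbol $\sigma$ whose result sort is a system sort (arguments of data sorts being compared by equality). A POA homomorphism is a homomorphism of the underlying algebras that is monotone on system sorts. For a sort-respecting map $\theta\colon X\to A$ and a term $t$ over $F\cup X$, $\theta t$ is the value of $t$ in $A$ under $\theta$. $(A,\leqslant)$ satisfies $\forall X\,H\to C$ iff for every sort-respecting $\theta\colon X\to A$ under which all atoms of $H$ hold, $C$ holds, where $t=t'$ holds iff $\theta t=\theta t'$ and $t\Rightarrow t'$ holds iff $\theta t\leqslant\theta t'$. Algebraic rewriting. A context $c[z]$ is a term $c$ over $(D\cup S,F\cup\{z\})$, where $z$ is a new variable, such that either $c=z$, or $c=\sigma(c_1,\dots,c_n)$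 with $\sigma$ an operation symbol of $F$ and exactly one $k\in\{1,\dots,n\}$ such that $c_k$ is a context, the other $c_i$ ($i\neq k$) being just $(D\cup S,F)$-terms. Let $B$ be a $(D\cup S,F)$-algebra. For a context $c[z]$ of sort $s'$ with $z$ of sort $s$, $B_c\colon B_s\to B_{s'}$ is the identity if $c=z$, and $B_c(b)=B_\sigma(B_{c_1},\dots,B_{c_k}(b),\dots,B_{c_n})$ if $c=\sigma(c_1,\dots,c_k[z],\dots,c_n)$. Let $\Delta_B=\{(b,b)\mid b\in B\}$ be the diagonal, and for a relation $\Omega\subseteq B\times B$ let $$\Gamma(\Omega)=\{(B_c(\theta t),B_c(\theta t'))\mid c[z]\text{ a context whose sort is a system sort, with } z \text{ of the sort of } t,t',\ (\forall X\,H\to(t\Rightarrow t'))\in\Gamma,\ \theta\colon X\to B,\ \theta H_=\subseteq\Delta_B,\ \theta H_\to\subseteq\Omega\}.$$ Put $\Gamma_{B,0}=\Delta_B$, $\Gamma_{B,k+1}=\Gamma_{B,k}^*\cup\Gamma(\Gamma_{B,k}^* )$, where $R^*$ is the reflexive-transitive closure of $R$. Define $b\longrightarrow_{\Gamma/B}b'$ iff $(b,b')\in\Gamma(\Gamma_{B,k}^* )$ for some $k\in\omega$, and let $\stackrel{*}{\longrightarrow}_{\Gamma/B}$ be the reflexive-transitive closure of $\longrightarrow_{\Gamma/B}$ (on data sorts it is equality; $(B,\stackrel{*}{\longrightarrow}_{\Gamma/B})$ uses its restriction to system sorts).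
   Formalization: In defining Γ(Ω), the side terms of a context may use elements of B as constants (not only closed terms), and every subcontext, not just the whole context, must have a system sort; with the literal definition (B,→* ) may fail to be monotone or free. *)

(* Defs.v *)
From mathcomp Require Import all_boot.
From Stdlib Require Import Relations FunctionalExtensionality ProofIrrelevance.
From Stdlib Require List.

Set Implicit Arguments.
Unset Strict Implicit.
Unset Printing Implicit Defensive.

Record category := Category {
  obj :> Type;
  hom : obj -> obj -> Type;
  idm : forall a, hom a a;
  comp : forall a b c, hom a b -> hom b c -> hom a c;  (* diagrammatic order *)
  comp_idl : forall a b (f : hom a b), comp (idm a) f = f;
  comp_idr : forall a b (f : hom a b), comp f (idm b) = f;
  comp_assoc : forall a b c d (f : hom a b) (g : hom b c) (h : hom c d),
    comp f (comp g h) = comp (comp f g) h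
}.
Arguments hom {_} _ _.
Arguments idm {_} _.
Arguments comp {_ _ _ _} _ _.

Record functor (C E : category) := Functor {
  fobj :> C -> E;
  fmap : forall a b : C, hom a b -> hom (fobj a) (fobj b);
  fmap_id : forall a : C, fmap (idm a) = idm (fobj a);
  fmap_comp : forall (a b c : C) (f : hom a b) (g : hom b c),
    fmap (comp f g) = comp (fmap f) (fmap g)
}.
Arguments fmap {_ _} _ {_ _} _.

Definition id_functor (C : category) : functor C C :=
  @Functor C C (fun a => a) (fun _ _ f => f)
    (fun _ => erefl) (fun _ _ _ _ _ => erefl).

Lemma comp_functor_id (C1 C2 C3 : category) (G : functor C1 C2)
    (H : functor C2 C3) (a : C1) :
  fmap H (fmap G (idm a)) = idm (H (G a)).
Proof. by rewrite !fmap_id. Qed.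

Lemma comp_functor_comp (C1 C2 C3 : category) (G : functor C1 C2)
    (H : functor C2 C3) (a b c : C1) (f : hom a b) (g : hom b c) :
  fmap H (fmap G (comp f g)) = comp (fmap H (fmap G f)) (fmap H (fmap G g)).
Proof. by rewrite !fmap_comp. Qed.

(* Diagrammatic order: first [G], then [H]. *)
Definition comp_functor (C1 C2 C3 : category)
    (G : functor C1 C2) (H : functor C2 C3) : functor C1 C3 :=
  @Functor C1 C3 (fun a => H (G a)) (fun _ _ f => fmap H (fmap G f))
    (comp_functor_id G H) (@comp_functor_comp _ _ _ G H).

Definition left_adjoint (C E : category) (L : functor C E) (U : functor E C)
    : Prop :=
  exists phi : forall (b : C) (a : E), hom (L b) a -> hom b (U a),
    [/\ forall b a, bijective (phi b a),
        forall (b b' : C) (a : E) (f : hom b' b) (g : hom (L b) a),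
          phi b' a (comp (fmap L f) g) = comp f (phi b a g) &
        forall (b : C) (a a' : E) (g : hom (L b) a) (h : hom a a'),
          phi b a' (comp g h) = comp (phi b a g) (fmap U h)].

Definition full_hom (C : category) (P : C -> Prop) (a b : {x : C | P x}) :=
  hom (sval a) (sval b).

Definition full_subcategory (C : category) (P : C -> Prop) : category :=
  @Category {x : C | P x} (@full_hom C P)
    (fun a => idm (sval a))
    (fun _ _ _ f g => comp f g)
    (fun _ _ f => comp_idl f)
    (fun _ _ f => comp_idr f)
    (fun _ _ _ _ f g h => comp_assoc f g h).

Record poa_signature := POASignature {
  data_sort : Type;
  system_sort : Type;
  op : seq (data_sort + system_sort) -> (data_sort + system_sort) -> Type
}.

(* The disjoint sum encodes the disjoint union of D and S. *)
Notation sort Sg := ((data_sort Sg + system_sort Sg)%type).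

Notation arg_sort w i := (tnth (in_tuple w) i).

Definition is_system (Sg : poa_signature) (s : sort Sg) : Prop :=
  if s is inr _ then True else False.

Inductive term (Sg : poa_signature) (X : sort Sg -> Type) : sort Sg -> Type :=
| Var (s : sort Sg) (x : X s) : term X s
| App (w : seq (sort Sg)) (s : sort Sg) (sigma : op w s)
    (args : forall i : 'I_(size w), term X (arg_sort w i)) : term X s.

Inductive atom (Sg : poa_signature) (X : sort Sg -> Type) : Type :=
| Equation (s : sort Sg) (t t' : term X s)
| Transition (s : system_sort Sg) (t t' : term X (inr s)).

Record poa_transition (Sg : poa_signature) := POATransition {
  vars : sort Sg -> Type;
  prem : seq (atom vars);
  concl_sort : system_sort Sg;
  concl_lhs : term vars (inr concl_sort);
  concl_rhs : term vars (inr concl_sort)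
}.

Record algebra (Sg : poa_signature) := Algebra {
  carrier :> sort Sg -> Type;
  interp : forall (w : seq (sort Sg)) (s : sort Sg), op w s ->
    (forall i : 'I_(size w), carrier (arg_sort w i)) -> carrier s
}.

Fixpoint term_val (Sg : poa_signature) (A : algebra Sg) (X : sort Sg -> Type)
    (theta : forall s, X s -> A s) (s : sort Sg) (t : term X s) : A s :=
  match t in term _ s return A s with
  | Var s x => theta s x
  | App w s sigma args => interp sigma (fun i => term_val theta (args i))
  end.

Definition is_hom (Sg : poa_signature) (A B : algebra Sg)
    (h : forall s, A s -> B s) : Prop :=
  forall (w : seq (sort Sg)) (s : sort Sg) (sigma : op w s)
    (a : forall i : 'I_(size w), A (arg_sort w i)),
    h s (interp sigma a) = interp sigma (fun i => h _ (a i)).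

Definition alg_hom (Sg : poa_signature) (A B : algebra Sg) :=
  {h : forall s, A s -> B s | is_hom h}.

Lemma id_is_hom (Sg : poa_signature) (A : algebra Sg) :
  is_hom (fun s (x : A s) => x).
Proof. by []. Qed.

Lemma comp_is_hom (Sg : poa_signature) (A B C : algebra Sg)
    (g : alg_hom A B) (h : alg_hom B C) :
  is_hom (fun s x => sval h s (sval g s x)).
Proof. by move=> w s sigma a; rewrite (svalP g) (svalP h). Qed.

Definition alg_id (Sg : poa_signature) (A : algebra Sg) : alg_hom A A :=
  exist _ _ (@id_is_hom Sg A).

Definition alg_comp (Sg : poa_signature) (A B C : algebra Sg)
    (g : alg_hom A B) (h : alg_hom B C) : alg_hom A C :=
  exist _ _ (comp_is_hom g h).

Lemma sval_inj (T : Type) (P : T -> Prop) (x y : {z : T | P z}) :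
  sval x = sval y -> x = y.
Proof.
case: x y => [x px] [y py] /= exy; subst y.
by rewrite (proof_irrelevance _ px py).
Qed.

Definition Mod_alg (Sg : poa_signature) : category.
Proof.
refine (@Category (algebra Sg) (@alg_hom Sg) (@alg_id Sg) (@alg_comp Sg)
          _ _ _) => *; exact: sval_inj.
Defined.

Definition rel_family (Sg : poa_signature) (A : algebra Sg) :=
  forall s : sort Sg, A s -> A s -> Prop.

Definition system_rel_family (Sg : poa_signature) (A : algebra Sg) :=
  forall s : system_sort Sg, A (inr s) -> A (inr s) -> Prop.

(* Extension of a relation on the system sorts by equality on data sorts. *)
Definition eq_on_data (Sg : poa_signature) (A : algebra Sg)
    (R : system_rel_family A) : rel_family A :=
  fun s => match s return A s -> A s -> Prop with
           | inl _ => fun a a' => a = a'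
           | inr s => R s
           end.

Record is_preordered (Sg : poa_signature) (A : algebra Sg)
    (le : system_rel_family A) : Prop := IsPreordered {
  le_refl : forall s (a : A (inr s)), le s a a;
  le_trans : forall s (a b c : A (inr s)), le s a b -> le s b c -> le s a c;
  le_mono : forall (w : seq (sort Sg)) (s : system_sort Sg)
    (sigma : op w (inr s)) (a a' : forall i : 'I_(size w), A (arg_sort w i)),
    (forall i, eq_on_data le (a i) (a' i)) ->
    le s (interp sigma a) (interp sigma a')
}.

Record poa (Sg : poa_signature) := POA {
  poa_alg : algebra Sg;
  poa_le : system_rel_family poa_alg;
  poa_preordered : is_preordered poa_le
}.

Definition is_poa_hom (Sg : poa_signature) (A B : poa Sg)
    (h : alg_hom (poa_alg A) (poa_alg B)) : Prop :=
  forall s a a', poa_le (s := s) a a' -> poa_le (sval h _ a) (sval h _ a').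

Definition poa_hom (Sg : poa_signature) (A B : poa Sg) :=
  {h : alg_hom (poa_alg A) (poa_alg B) | is_poa_hom h}.

Lemma id_is_poa_hom (Sg : poa_signature) (A : poa Sg) :
  @is_poa_hom Sg A A (alg_id (poa_alg A)).
Proof. by []. Qed.

Lemma comp_is_poa_hom (Sg : poa_signature) (A B C : poa Sg)
    (g : poa_hom A B) (h : poa_hom B C) :
  is_poa_hom (alg_comp (sval g) (sval h)).
Proof. by move=> s a a' le_aa'; apply: (svalP h); apply: (svalP g). Qed.

Definition poa_id (Sg : poa_signature) (A : poa Sg) : poa_hom A A :=
  exist _ _ (@id_is_poa_hom Sg A).

Definition poa_comp (Sg : poa_signature) (A B C : poa Sg)
    (g : poa_hom A B) (h : poa_hom B C) : poa_hom A C :=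
  exist _ _ (comp_is_poa_hom g h).

Definition Mod_poa (Sg : poa_signature) : category.
Proof.
refine (@Category (poa Sg) (@poa_hom Sg) (@poa_id Sg) (@poa_comp Sg)
          _ _ _) => *; apply: sval_inj; exact: sval_inj.
Defined.

Definition atom_holds (Sg : poa_signature) (A : algebra Sg)
    (R : system_rel_family A) (X : sort Sg -> Type)
    (theta : forall s, X s -> A s) (a : atom X) : Prop :=
  match a with
  | Equation s t t' => term_val theta t = term_val theta t'
  | Transition s t t' => R s (term_val theta t) (term_val theta t')
  end.

Definition satisfies (Sg : poa_signature) (A : poa Sg)
    (phi : poa_transition Sg) : Prop :=
  forall theta : forall s, vars phi s -> poa_alg A s,
    List.Forall (atom_holds (@poa_le Sg A) theta) (prem phi) ->
    poa_le (term_val theta (concl_lhs phi)) (term_val theta (concl_rhs phi)).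

Definition satisfies_all (Sg : poa_signature) (Gamma : poa_transition Sg -> Prop)
    (A : poa Sg) : Prop :=
  forall phi, Gamma phi -> satisfies A phi.

Definition Mod_poa_sat (Sg : poa_signature)
    (Gamma : poa_transition Sg -> Prop) : category :=
  @full_subcategory (Mod_poa Sg) (satisfies_all Gamma).

Definition forgetful (Sg : poa_signature) (Gamma : poa_transition Sg -> Prop) :
    functor (Mod_poa_sat Gamma) (Mod_alg Sg) :=
  @Functor (Mod_poa_sat Gamma) (Mod_alg Sg)
    (fun A => poa_alg (sval A)) (fun _ _ h => sval h)
    (fun _ => erefl) (fun _ _ _ _ _ => erefl).

(* [context Y z s]: contexts of sort [s] over the operations and the
   constants [Y], whose hole has sort [z]. *)
Inductive context (Sg : poa_signature) (Y : sort Sg -> Type) (z : sort Sg) :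
    sort Sg -> Type :=
| Hole : context Y z z
| CApp (w : seq (sort Sg)) (s : sort Sg) (sigma : op w s) (k : 'I_(size w))
    (ck : context Y z (arg_sort w k))
    (cs : forall i : 'I_(size w), i <> k -> term Y (arg_sort w i)) :
    context Y z s.

Fixpoint context_val (Sg : poa_signature) (B : algebra Sg)
    (Y : sort Sg -> Type) (eta : forall s, Y s -> B s) (z s : sort Sg)
    (c : context Y z s) (b : B z) : B s :=
  match c in context _ _ s return B s with
  | Hole => b
  | CApp w s sigma k ck cs =>
      interp sigma (fun i =>
        match @eqP _ i k with
        | ReflectT e => eq_rect_r (fun j => B (arg_sort w j))
                          (context_val eta ck b) e
        | ReflectF ne => term_val eta (cs i ne)
        end)
  end.

(* The context and all its subcontexts have system sorts.  Asking this of the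
   outermost sort only would be too weak when some operation takes a system
   argument to a data sort: preordered algebras put no monotonicity requirement
   on such an operation, so rewriting must not take place below it.  Without
   such operations, every context whose hole has a system sort is of this
   kind. *)
Fixpoint system_context (Sg : poa_signature) (Y : sort Sg -> Type)
    (z s : sort Sg) (c : context Y z s) : Prop :=
  match c with
  | Hole => is_system z
  | CApp w s sigma k ck cs => is_system s /\ system_context ck
  end.

(* The side terms of a context may use the elements of [B] as constants
   ([Y := B], valued identically): with closed side terms only, the rewriting
   relation would not be compatible with the operations of [B] at arguments
   that are not values of closed terms. *)
Definition Gamma_step (Sg : poa_signature) (Gamma : poa_transition Sg -> Prop)
    (B : algebra Sg) (Omega : rel_family B) : rel_family B :=
  fun s b b' =>
    exists (phi : poa_transition Sg) (theta : forall r, vars phi r -> B r)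
           (c : context (carrier B) (inr (concl_sort phi)) s),
      [/\ Gamma phi,
          List.Forall (atom_holds (fun r => Omega (inr r)) theta) (prem phi),
          system_context c,
          b = context_val (fun _ x => x) c (term_val theta (concl_lhs phi)) &
          b' = context_val (fun _ x => x) c (term_val theta (concl_rhs phi))].

Definition star (Sg : poa_signature) (B : algebra Sg) (R : rel_family B) :
    rel_family B :=
  fun s => clos_refl_trans (B s) (R s).

Fixpoint Gamma_rel (Sg : poa_signature) (Gamma : poa_transition Sg -> Prop)
    (B : algebra Sg) (k : nat) : rel_family B :=
  match k with
  | 0 => fun s b b' => b = b'
  | k.+1 => fun s b b' =>
      star (Gamma_rel Gamma k) b b' \/
      Gamma_step Gamma (star (Gamma_rel Gamma k)) b b'
  end.

Definition rewrites (Sg : poa_signature) (Gamma : poa_transition Sg -> Prop)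
    (B : algebra Sg) : rel_family B :=
  fun s b b' =>
    exists k : nat, Gamma_step Gamma (star (@Gamma_rel Sg Gamma B k)) b b'.

Definition rewrites_star (Sg : poa_signature)
    (Gamma : poa_transition Sg -> Prop) (B : algebra Sg) :
    system_rel_family B :=
  fun s => star (@rewrites Sg Gamma B) (s := inr s).

(* Main.v *)
From mathcomp Require Import all_boot.
From Stdlib Require Import Relations FunctionalExtensionality ProofIrrelevance.
From Stdlib Require List.
Require Import Defs.

Set Implicit Arguments.
Unset Strict Implicit.
Unset Printing Implicit Defensive.

(** Rewriting is the least preorder that turns [B] into a model of [Gamma]; the
    left adjoint does not touch the underlying algebra at all.

    It is a model.  Monotonicity of the operations is obtained by changing the
    arguments of an operation one at a time ([pointwise_update]), each change
    being a sequence of rewrites inside one more layer of context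
    ([star_rewrites_update]).  A transition of [Gamma] holds because its
    finitely many premises use finitely many rewrite steps, hence are all
    witnessed at one common stage of the construction of the rewriting relation
    ([premises_bounded]); the conclusion is then a rewrite step at that stage,
    in the empty context.

    It is the least one.  If [h : B -> A] is a homomorphism into a model of
    [Gamma], the stages of the construction are sent into the preorder of [A],
    by induction on the stage ([Gamma_rel_sound]): satisfaction of [Gamma] in
    [A] handles the instance of the rule, monotonicity of the operations of [A]
    handles the surrounding context.  So every homomorphism [B -> A] is already
    monotone from rewriting to the preorder of [A], and forgetting monotonicity
    is a natural bijection between the two kinds of morphisms: this is the
    adjunction.  When the preorder of [A] is its own rewriting relation, the
    same fact gives the functoriality of the construction. *)

(** * Changing the entries of a finite family one at a time *)

(** The match is the one of [context_val], so that plugging a value into a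
    context below an operation updates its arguments by conversion. *)
Definition update (I : eqType) (T : I -> Type) (f : forall i, T i) (k : I)
    (x : T k) : forall i, T i :=
  fun i => match @eqP _ i k with
           | ReflectT e => eq_rect_r T x e
           | ReflectF _ => f i
           end.

Lemma update_same (I : eqType) (T : I -> Type) (f : forall i, T i) (k : I) :
  update f (f k) = f.
Proof.
apply: functional_extensionality_dep => i; rewrite /update.
by case: eqP => // e; subst k.
Qed.

(** Finiteness of the index type is what makes pointwise related families
    reachable from one another by updates: one update per index. *)
Lemma pointwise_update (I : finType) (T : I -> Type)
    (R : forall i, T i -> T i -> Prop) (Q : (forall i, T i) -> Prop)
    (a a' : forall i, T i) :
  (forall i x, R i x x) -> (forall i, R i (a i) (a' i)) ->
  (forall f k x, R k (f k) x -> Q f -> Q (update f x)) ->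
  Q a -> Q a'.
Proof.
move=> Rxx Raa' Qupd Qa.
pose mix (ks : seq I) i := if i \in ks then a' i else a i.
have Qmix ks : Q (mix ks).
  elim: ks => [|k ks IHks]; first exact: Qa.
  have -> : mix (k :: ks) = update (mix ks) (a' k).
    apply: functional_extensionality_dep => i; rewrite /update /mix inE.
    by case: eqP => // e; subst k.
  by apply: Qupd IHks; rewrite /mix; case: ifP.
suff -> : a' = mix (enum I) by [].
by apply: functional_extensionality_dep => i; rewrite /mix mem_enum.
Qed.

(** * Rewriting and its stages *)

Section Rewriting.
Variables (Sg : poa_signature) (Gamma : poa_transition Sg -> Prop).
Variable B : algebra Sg.

Local Notation stage k := (star (@Gamma_rel Sg Gamma B k)).

Lemma stage_leq k l s (b b' : B s) : k <= l -> stage k b b' -> stage l b b'.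
Proof.
move=> /subnK <-; elim: (l - k) => [//|m IHm] /IHm bb'.
by apply: rt_step; left.
Qed.

Lemma rewrites_star_stage s (b b' : B s) :
  star (@rewrites Sg Gamma B) b b' -> exists k, stage k b b'.
Proof.
elim=> {b b'} [b b' [k bb']|b|b c d _ [k bc] _ [l cd]].
- by exists k.+1; apply: rt_step; right.
- by exists 0; apply: rt_refl.
- exists (maxn k l); apply: (rt_trans _ _ _ c).
    exact: stage_leq (leq_maxl k l) bc.
  exact: stage_leq (leq_maxr k l) cd.
Qed.

Lemma atom_holds_mono (X : sort Sg -> Type) (theta : forall s, X s -> B s)
    (R R' : system_rel_family B) (a : atom X) :
  (forall s b b', R s b b' -> R' s b b') ->
  atom_holds R theta a -> atom_holds R' theta a.
Proof. by case: a => [//|s t t'] RR' /= /RR'. Qed.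

(** Stages increase, so the maximum of the stages witnessing the premises
    separately witnesses them all. *)
Lemma premises_bounded (X : sort Sg -> Type) (theta : forall s, X s -> B s)
    (H : seq (atom X)) :
  List.Forall (atom_holds (@rewrites_star Sg Gamma B) theta) H ->
  exists k, List.Forall (atom_holds (fun r => stage k (s := inr r)) theta) H.
Proof.
elim=> [|a H' a_holds _ [k H'_holds]]; first by exists 0.
have [l a_l] : exists l, atom_holds (fun r => stage l (s := inr r)) theta a.
  case: a a_holds => [s t t' tt'|s t t' /rewrites_star_stage [l tt']].
    by exists 0.
  by exists l.
exists (maxn k l); constructor.
  by apply: atom_holds_mono a_l => s b b'; apply: stage_leq (leq_maxr k l).
apply: List.Forall_impl H'_holds => {a_holds a_l} a.
by apply: atom_holds_mono => s b b'; apply: stage_leq (leq_maxl k l).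
Qed.

(** A context can be extended by an operation whose other arguments are
    elements of [B], used as constants; the result sort has to be a system
    sort because rewriting never takes place below a data sort. *)
Lemma star_rewrites_update (w : seq (sort Sg)) (s : system_sort Sg)
    (sigma : op w (inr s)) (f : forall i : 'I_(size w), B (arg_sort w i))
    (k : 'I_(size w)) (x y : B (arg_sort w k)) :
  star (@rewrites Sg Gamma B) x y ->
  @rewrites_star Sg Gamma B s (interp sigma (update f x))
    (interp sigma (update f y)).
Proof.
elim=> {x y} [x y [n [phi [theta [c [Gphi prem_phi sys_c -> ->]]]]]|x|].
- apply: rt_step; exists n, phi, theta.
  by exists (CApp sigma c (fun i _ => Var (f i))).
- exact: rt_refl.
- by move=> x y z _ xy _ yz; apply: rt_trans xy yz.
Qed.

Lemma rewrites_preordered : is_preordered (@rewrites_star Sg Gamma B).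
Proof.
split=> [s a|s a b c ab bc|w s sigma a a' aa'].
- exact: rt_refl.
- exact: rt_trans ab bc.
- pose R (i : 'I_(size w)) := @star _ B (@rewrites Sg Gamma B) (arg_sort w i).
  have eq_on_data_star r (x y : B r) :
      eq_on_data (@rewrites_star Sg Gamma B) x y ->
      star (@rewrites Sg Gamma B) x y.
    by case: r x y => [r|r] x y //= ->; apply: rt_refl.
  pose Q f := @rewrites_star Sg Gamma B s (interp sigma a) (interp sigma f).
  apply: (@pointwise_update _ _ R Q a a').
  + by move=> i x; apply: rt_refl.
  + by move=> i; apply: eq_on_data_star.
  + move=> f k x fx af; apply: rt_trans af _.
    (* The family [f] is itself an update at [k], by its own entry. *)
    by rewrite -{1}(update_same f k); apply: star_rewrites_update.
  + exact: rt_refl.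
Qed.

Lemma rewrites_satisfies : satisfies_all Gamma (POA rewrites_preordered).
Proof.
move=> phi Gphi theta /premises_bounded [k prem_phi] /=.
by apply: rt_step; exists k, phi, theta, (Hole _ _).
Qed.

End Rewriting.

(** * Homomorphisms into models preserve rewriting *)

Section Soundness.
Variables (Sg : poa_signature) (Gamma : poa_transition Sg -> Prop).
Variables (B : algebra Sg) (A : poa Sg) (h : alg_hom B (poa_alg A)).

Lemma hom_term_val (X : sort Sg -> Type) (theta : forall s, X s -> B s) s
    (t : term X s) :
  sval h s (term_val theta t) = term_val (fun r x => sval h r (theta r x)) t.
Proof.
elim: t => //= w r sigma args IHargs; rewrite (svalP h); congr interp.
exact: functional_extensionality_dep.
Qed.

Lemma eq_on_data_refl s (a : poa_alg A s) : eq_on_data (@poa_le Sg A) a a.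
Proof. by case: s a => s a //=; apply: (le_refl (poa_preordered A)). Qed.

(** Operations of data sort need not be monotone: this is where the system
    sorts all along the context are used. *)
Lemma context_mono (Y : sort Sg -> Type) (eta : forall s, Y s -> B s)
    (z : system_sort Sg) s (c : context Y (inr z) s) (b b' : B (inr z)) :
  system_context c -> poa_le (sval h _ b) (sval h _ b') ->
  eq_on_data (@poa_le Sg A) (sval h _ (context_val eta c b))
    (sval h _ (context_val eta c b')).
Proof.
move=> + bb'; elim: c => [//|w [r|r] sigma k ck IHck cs] /= [//= _ sys_ck].
rewrite !(svalP h); apply: (le_mono (poa_preordered A)) => i.
case: eqP => [e|ne]; last exact: eq_on_data_refl.
by subst k; apply: IHck.
Qed.

Hypothesis A_sat : satisfies_all Gamma A.

(** Composing the instantiation of the rule with [h] gives an instantiation in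
    [A], where the rule holds. *)
Lemma Gamma_step_sound (Omega : rel_family B) s (b b' : B (inr s)) :
  (forall r (x y : B (inr r)), Omega _ x y ->
     poa_le (sval h _ x) (sval h _ y)) ->
  Gamma_step Gamma Omega b b' -> poa_le (sval h _ b) (sval h _ b').
Proof.
move=> Omega_le [phi [theta [c [Gphi prem_phi sys_c -> ->]]]].
apply: (context_mono _ sys_c); rewrite !hom_term_val.
apply: (A_sat Gphi); apply: List.Forall_impl prem_phi.
by case=> [r t t' /= tt'|r t t' /= /Omega_le]; rewrite -!hom_term_val // tt'.
Qed.

Lemma star_sound (R : rel_family B) s (b b' : B (inr s)) :
  (forall x y : B (inr s), R _ x y -> poa_le (sval h _ x) (sval h _ y)) ->
  star R b b' -> poa_le (sval h _ b) (sval h _ b').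
Proof.
move=> R_le; elim=> {b b'} [b b' /R_le //|b|b c d _ bc _ cd].
  exact: (le_refl (poa_preordered A)).
exact: (le_trans (poa_preordered A)) bc cd.
Qed.

Lemma Gamma_rel_sound k s (b b' : B (inr s)) :
  star (@Gamma_rel Sg Gamma B k) b b' -> poa_le (sval h _ b) (sval h _ b').
Proof.
elim: k s b b' => [|k IHk] s b b'; apply: star_sound => x y /=.
  by move=> ->; apply: (le_refl (poa_preordered A)).
by case=> [/IHk //|]; apply: Gamma_step_sound.
Qed.

(** Both the functoriality of the construction and its universal property are
    instances: no homomorphism into a model can fail to be monotone. *)
Lemma rewrites_star_sound s (b b' : B (inr s)) :
  @rewrites_star Sg Gamma B s b b' -> poa_le (sval h _ b) (sval h _ b').
Proof. by move=> /rewrites_star_stage [k]; apply: Gamma_rel_sound. Qed.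

End Soundness.

(** * The adjunction *)

Section Adjunction.
Variables (Sg : poa_signature) (Gamma : poa_transition Sg -> Prop).

Definition rewriting_model (B : algebra Sg) : Mod_poa_sat Gamma :=
  exist _ (POA (rewrites_preordered Gamma B)) (@rewrites_satisfies Sg Gamma B).

Definition monotone_hom (B : algebra Sg) (A : Mod_poa_sat Gamma)
    (h : alg_hom B (poa_alg (sval A))) : hom (rewriting_model B) A :=
  exist (@is_poa_hom Sg (sval (rewriting_model B)) (sval A)) h
    (@rewrites_star_sound Sg Gamma B (sval A) h (svalP A)).

Definition rewriting_functor : functor (Mod_alg Sg) (Mod_poa_sat Gamma).
Proof.
refine (@Functor (Mod_alg Sg) (Mod_poa_sat Gamma) rewriting_model
          (fun B B' h => @monotone_hom B (rewriting_model B') h) _ _) => *;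
  exact: sval_inj.
Defined.

Lemma rewriting_left_adjoint : left_adjoint rewriting_functor (forgetful Gamma).
Proof.
exists (fun B A g => sval g); split=> // B A.
by exists (@monotone_hom B A) => // g; apply: sval_inj.
Qed.

(** The two functors agree on objects and morphisms by conversion. *)
Lemma rewriting_left_inverse :
  comp_functor rewriting_functor (forgetful Gamma) = id_functor (Mod_alg Sg).
Proof.
by rewrite /comp_functor /id_functor /=; congr Functor; apply: proof_irrelevance.
Qed.

End Adjunction.

Theorem theorem4p4 (Sg : poa_signature) (Gamma : poa_transition Sg -> Prop) :
  exists L : functor (Mod_alg Sg) (Mod_poa_sat Gamma),
    left_adjoint L (forgetful Gamma) /\
    comp_functor L (forgetful Gamma) = id_functor (Mod_alg Sg) /\
    (forall B : algebra Sg,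
       exists (pre : is_preordered (@rewrites_star Sg Gamma B))
              (sat : satisfies_all Gamma (POA pre)),
         fobj L B = exist (satisfies_all Gamma) (POA pre) sat).
Proof.
exists (rewriting_functor Gamma); split; first exact: rewriting_left_adjoint.
split; first exact: rewriting_left_inverse.
move=> B; exists (rewrites_preordered Gamma B).
by exists (@rewrites_satisfies Sg Gamma B).
Qed.
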